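(* Let $G=(U\cup W,E)$ be an $(r,n-r)$-bipartite graph with partitions $U=\{u_1,\dots,u_r\}$ and $W=\{w_1,\dots,w_{n-r}\}$, and let $m>1$ be an integer. Let $S^m(G)$ be the graph obtained from $G$ by substituting every vertex in $U$ with $e^m$ and adding $m-1$ pendants to every vertex in $W$. Suppose that all vertices in $U$ have odd degree in $G$, and that every pair of distinct vertices from $U$ has an even number of (or zero) common neighbors in $G$. Then $$C^m(G)=S^m(G)*w_1*\cdots*w_{n-r},$$ i.e., $C^m(G)$ is obtained from $S^m(G)$ by performing local complementation on all vertices in $W$ (the order of these operations is not important).
   Context: All graphs are finite, simple and undirected. For a graph $G=(V,E)$ and $v\in V$, $N_v$ is the set of vertices adjacent to $v$. Local complementation (LC) on $v$ transforms $G$ into $G*v$ by replacing the induced subgraph of $G$ on $N_v$ by its complement; $G*v_1*\cdots*v_s$ means applying LC on $v_1$, then $v_2$, and so on. $e^m$ is the graph on $m$ vertices with no edges and $c^m$ is the complete graph on $m$ vertices. Substituting a vertex $v$ of $G=(V,E)$ with a graph $H=(V',E')$, $V\cap V'=\emptyset$, means forming the graph with vertex set $(V\setminus\{v\})\cup V'$ whose edge set is obtained from $E\cup E'$ by removing all edges incident on $v$ and joining all vertices in $V'$ to $w$ whenever $\{v,w\}\in E$. Adding a pendant at a vertex $v$ means adding a new vertex $w$ and a new edge $\{v,w\}$. $C^m(G)$ is the graph obtained by substituting every vertex of $G$ with $c^m$. In the equality, the vertices of the two graphs are identified as follows: the $m$ vertices of the $e^m$ replacing $u_i$ are identified with the $m$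 vertices of the $c^m$ replacing $u_i$, and $w_j$ together with its $m-1$ added pendants is identified with the $m$ vertices of the $c^m$ replacing $w_j$. An $(a,b)$-bipartite graph is a bipartite graph whose two partitions (independent sets decomposing the vertex set) have sizes $a$ and $b$. *)

(* Defs.v *)
(* Plain MathComp (boot) development. *)
From mathcomp Require Import all_boot.

Set Implicit Arguments.
Unset Strict Implicit.
Unset Printing Implicit Defensive.

(* A finite graph whose vertices are taken from an ambient finite type T of
   possible vertices; an edge {x, y} is the two-element set [set x; y].  The
   record does not enforce well-formedness, which is the predicate
   simple_graph below. *)
Record graph (T : finType) : Type := Graph {
  vertices : {set T};
  edges : {set {set T}}
}.

Section Graphs.
Variable T : finType.
Implicit Types (G H : graph T) (A U W : {set T}) (v w x y : T).

Definition pairs A : {set {set T}} := [set e : {set T} | (e \subset A) && (#|e| == 2)].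

Definition simple_graph G : Prop := edges G \subset pairs (vertices G).

Definition adjacent G x y : bool := [set x; y] \in edges G.

Definition nbhd G v : {set T} := [set x | adjacent G v x].

Definition degree G v : nat := #|nbhd G v|.

Definition common_nbhd G x y : {set T} := nbhd G x :&: nbhd G y.

Definition independent G A : Prop := {in A &, forall x y, ~~ adjacent G x y}.

Definition bipartite_parts G U W (a b : nat) : Prop :=
  [/\ vertices G = U :|: W, [disjoint U & W],
      independent G U /\ independent G W & #|U| = a /\ #|W| = b].

Definition edgeless A : graph T := Graph A set0.

Definition complete A : graph T := Graph A (pairs A).

(* Toggles exactly the pairs of distinct neighbours of v. *)
Definition local_compl G v : graph T :=
  Graph (vertices G)
    ((edges G :\: pairs (nbhd G v)) :|: (pairs (nbhd G v) :\: edges G)).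

(* local_compls G [:: v1; ...; vs] is G * v1 * ... * vs, v1 being applied
   first. *)
Definition local_compls G (s : seq T) : graph T := foldl local_compl G s.

(* Meaningful when v is a vertex of G and the vertices of G and H are
   disjoint. *)
Definition substitute G v H : graph T :=
  Graph ((vertices G :\ v) :|: vertices H)
    ([set e in edges G :|: edges H | v \notin e]
     :|: [set [set x; w] | x in vertices H, w in nbhd G v]).

(* Meaningful when v is a vertex of G and w is not. *)
Definition add_pendant G v w : graph T :=
  Graph (w |: vertices G) ([set v; w] |: edges G).

End Graphs.

Definition relabel (T T' : finType) (f : T -> T') (G : graph T) : graph T' :=
  Graph (f @: vertices G) [set f @: (e : {set T}) | e in edges G].

(* Vertices available to C^m(G) and S^m(G) when G has vertices in V: inl v is
   the vertex v of G itself and the inr (v, i), i < m, are m fresh vertices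
   attached to v. *)
Notation vertex_names V m := (V + V * 'I_m)%type.

Section Blowups.
Variables (V : finType) (m : nat).
Implicit Types (G : graph V) (U W : {set V}) (v : V).

Definition old (v : V) : vertex_names V m := inl v.

Definition copies v : {set vertex_names V m} := [set inr (v, i) | i : 'I_m].

(* The m - 1 indices 0 < i < m. *)
Definition pendant_seq v : seq (vertex_names V m) :=
  [seq inr (v, i) | i : 'I_m <- enum 'I_m & 0 < val i].

(* Vertices are substituted one after the other; since the graphs substituted
   for distinct vertices are disjoint, the order is irrelevant and the
   enumeration order of A is used. *)
Definition substitute_all (K : graph (vertex_names V m)) (A : {set V})
    (H : V -> graph (vertex_names V m)) : graph (vertex_names V m) :=
  foldl (fun K v => substitute K (old v) (H v)) K (enum A).

Definition add_pendants (K : graph (vertex_names V m)) v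
    : graph (vertex_names V m) :=
  foldl (fun K p => add_pendant K (old v) p) K (pendant_seq v).

Definition Cm G : graph (vertex_names V m) :=
  substitute_all (relabel old G) (vertices G) (fun v => complete (copies v)).

Definition Sm G U W : graph (vertex_names V m) :=
  foldl add_pendants
    (substitute_all (relabel old G) U (fun u => edgeless (copies u)))
    (enum W).

(* f identifies the m vertices of S^m(G) coming from each vertex v of G with
   the m vertices of the complete graph replacing v in C^m(G).  As the two
   sides of each equality have the same cardinality m, and the right-hand sides
   are pairwise disjoint, f is a bijection from the vertices of S^m(G) to those
   of C^m(G).  No particular matching inside the m-sets is imposed. *)
Definition identification U W
    (f : vertex_names V m -> vertex_names V m) : Prop :=
  {in U, forall u, f @: copies u = copies u} /\
  {in W, forall w, f @: (old w |: [set p in pendant_seq w]) = copies w}.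

Lemma identification_exists U W :
  1 < m -> exists f, identification U W f.
Proof.
move=> m_gt1; pose i0 := Ordinal (ltnW m_gt1).
exists (fun x => match x with inl v => inr (v, i0) | inr p => inr p end).
split=> [u _ | w _]; apply/setP=> x; apply/imsetP/imsetP.
- by case=> _ /imsetP[i _ ->] ->; exists i.
- by case=> i _ ->; exists (inr (u, i)) => //; apply: imset_f.
- case=> y; rewrite !inE => /orP[/eqP-> -> | /mapP[i _ ->] ->].
    by exists i0.
  by exists i.
- case=> i _ ->; have [i_gt0 | i_le0] := ltnP 0 i.
    exists (inr (w, i)) => //; rewrite !inE map_f ?orbT //.
    by rewrite mem_filter i_gt0 mem_enum.
  exists (old w); first by rewrite !inE eqxx.
  by congr (inr (w, _)); apply/val_inj/eqP; rewrite -leqn0.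
Qed.

End Blowups.

(* Main.v *)
Require Import Defs.
From mathcomp Require Import all_boot.

Set Implicit Arguments.
Unset Strict Implicit.
Unset Printing Implicit Defensive.

(** Write S for S^m(G).  In S, two names can be adjacent only if one of them is
    an original vertex w of W: its neighbours are the copies of the
    G-neighbours of w, which lie in U, and the pendants of w.  In particular no
    two vertices of W are adjacent in S, so local complementation at one of
    them leaves the neighbourhoods of the others untouched, and after all of
    them a pair {x, y} of distinct vertices is flipped exactly when the number
    of w in W adjacent in S to both x and y is odd
    ([adjacent_local_compls]).  This also explains why the order is irrelevant.

    It remains to count these w for each kind of pair
    ([adjacent_local_compls_Sm]).
    - For copies of u and u' in U they are the common G-neighbours of u and u'.
      There are evenly many if u and u' differ, and deg u many, an odd number,
      if u = u': exactly the copies of the same vertex become adjacent.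
    - For a copy of u and a pendant of w, the only candidate is w, and it counts
      when u and w are adjacent in G: the pendants of w acquire the
      U-neighbours that w itself has in S.
    - Two pendants are flipped when they hang at the same vertex of W.
    - A pair that contains an element of W is never flipped.
    In each case the result is adjacent when the underlying vertices of G are
    adjacent or equal, which describes C^m(G) ([CmP]).

    The edges of S and C^m(G) are found by induction along the iterated
    constructions ([SmP], [CmP]), and the identification preserves the
    underlying vertex of G and is bijective ([identificationP]), so that
    equality of graphs can be read off from adjacency ([graph_ext]). *)

(** * Adjacency in simple graphs *)

Section Adjacency.
Variable T : finType.
Implicit Types (G H : graph T) (A e : {set T}) (v w x y : T).

Lemma eq_set2 x y a b :
  ([set x; y] == [set a; b]) =
  (x == a) && (y == b) || (x == b) && (y == a).
Proof.
apply/eqP/idP=> [/setP eq_xy | /orP[] /andP[/eqP-> /eqP->] //]; last exact: setUC.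
have := (eq_xy x, eq_xy y, eq_xy a, eq_xy b); rewrite !inE !eqxx ?orbT /=.
rewrite (eq_sym a) (eq_sym b) (eq_sym a y) (eq_sym b y) => -[[[]]].
by case: (x == a) (x == b) (y == a) (y == b) => [] [] [] [].
Qed.

Lemma adjacentC G x y : adjacent G x y = adjacent G y x.
Proof. by rewrite /adjacent setUC. Qed.

Lemma set2_pairs A x y : ([set x; y] \in pairs A) = [&& x \in A, y \in A & x != y].
Proof.
by rewrite inE subUset !sub1set cards2 -andbA; case: (x != y); rewrite ?andbF.
Qed.

Lemma pairsP A e :
  reflect (exists a b, [/\ a \in A, b \in A, a != b & e = [set a; b]])
          (e \in pairs A).
Proof.
apply: (iffP idP) => [pAe | [a [b [Aa Ab ab ->]]]]; last first.
  by rewrite set2_pairs Aa Ab.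
have := pAe; rewrite inE => /andP[_ /cards2P[a [b [ab def_e]]]].
by move: pAe; rewrite def_e set2_pairs => /and3P[Aa Ab _]; exists a, b.
Qed.

Lemma pairsS A (B : {set T}) : A \subset B -> pairs A \subset pairs B.
Proof.
by move=> sAB; apply/subsetP=> e; rewrite !inE => /andP[/subset_trans->].
Qed.

Lemma simple_adjacent G x y : simple_graph G -> adjacent G x y ->
  [/\ x \in vertices G, y \in vertices G & x != y].
Proof. by move=> /subsetP sG /sG; rewrite set2_pairs => /and3P. Qed.

Lemma nbhd_sub G v : simple_graph G -> nbhd G v \subset vertices G.
Proof.
by move=> sG; apply/subsetP=> x; rewrite inE => /(simple_adjacent sG)[].
Qed.

(** Simplicity is essential: adjacency does not see members of the edge set
    other than two-element sets. *)
Lemma graph_ext G H :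
  simple_graph G -> simple_graph H -> vertices G = vertices H ->
  {in vertices G &, forall x y, adjacent G x y = adjacent H x y} -> G = H.
Proof.
move=> sG sH eqV eqA; case: G H sG sH eqV eqA => VG EG [VH EH] /subsetP sG.
move=> /subsetP sH /= eqV eqA; rewrite -eqV in sH *; congr Graph.
apply/setP=> e; have [/pairsP[a [b [Va Vb _ ->]]] | notVe] := boolP (e \in pairs VG).
  exact: eqA.
by rewrite (contraNF (sG e)) ?(contraNF (sH e)).
Qed.

Lemma simple_complete A : simple_graph (complete A).
Proof. exact: subxx. Qed.

Lemma simple_edgeless A : simple_graph (edgeless A).
Proof. exact: sub0set. Qed.

Lemma adjacent_complete A x y :
  adjacent (complete A) x y = [&& x \in A, y \in A & x != y].
Proof. exact: set2_pairs. Qed.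

Lemma adjacent_edgeless A x y : adjacent (edgeless A) x y = false.
Proof. exact: in_set0. Qed.

Lemma adjacent_substitute G v H x y :
  adjacent (substitute G v H) x y =
  [|| [&& v != x, v != y & adjacent G x y || adjacent H x y],
      (x \in vertices H) && adjacent G v y
    | (y \in vertices H) && adjacent G v x].
Proof.
rewrite /adjacent !inE negb_or -!/(adjacent _ _ _) andbC -!andbA.
congr (_ || _); apply/imset2P/orP=> [[a b Ha] | [] /andP[Hx Hy]].
- rewrite inE => Hb /eqP; rewrite eq_set2.
  by case/orP=> /andP[/eqP-> /eqP->]; rewrite Ha Hb; [left | right].
- by exists x y; rewrite ?inE.
- by exists y x; rewrite ?inE // setUC.
Qed.

Lemma simple_substitute G v H :
  simple_graph G -> simple_graph H -> [disjoint vertices G & vertices H] ->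
  simple_graph (substitute G v H).
Proof.
move=> sG sH dGH; apply/subsetP=> e /=; rewrite in_setU => /orP[|].
  rewrite inE in_setU => /andP[/orP[/(subsetP sG) | /(subsetP sH)]].
    case/pairsP=> a [b [Ga Gb ab ->]]; rewrite in_set2 negb_or => /andP[va vb].
    by rewrite set2_pairs !inE Ga Gb ab (eq_sym a) (eq_sym b) va vb.
  case/pairsP=> a [b [Ha Hb ab ->]] _.
  by rewrite set2_pairs !inE Ha Hb ab !orbT.
case/imset2P=> x w Hx; rewrite inE => /(simple_adjacent sG)[_ Gw vw] ->.
rewrite set2_pairs !inE Hx Gw (eq_sym w) vw orbT /=.
by rewrite (contraTneq _ Hx) // => ->; rewrite (disjointFr dGH).
Qed.

Lemma adjacent_add_pendant G v w x y :
  adjacent (add_pendant G v w) x y = ([set x; y] == [set v; w]) || adjacent G x y.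
Proof. by rewrite /adjacent !inE. Qed.

Lemma simple_add_pendant G v w :
  simple_graph G -> v \in vertices G -> v != w -> simple_graph (add_pendant G v w).
Proof.
move=> sG Gv vw; rewrite /simple_graph subUset sub1set set2_pairs !inE eqxx.
by rewrite Gv orbT vw /= (subset_trans sG) // pairsS // subsetUr.
Qed.

Lemma adjacent_local_compl G v x y :
  adjacent (local_compl G v) x y =
  adjacent G x y (+) [&& x != y, adjacent G v x & adjacent G v y].
Proof.
rewrite {1}/adjacent in_setU !in_setD set2_pairs -/(adjacent _ _ _) !inE.
by case: (adjacent G x y) (x != y) (adjacent G v x) (adjacent G v y)
  => [] [] [] [].
Qed.

Lemma simple_local_compl G v : simple_graph G -> simple_graph (local_compl G v).
Proof.
move=> sG; rewrite /simple_graph subUset !(subset_trans (subsetDl _ _)) //.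
by rewrite pairsS ?nbhd_sub.
Qed.

Lemma simple_local_compls G s : simple_graph G -> simple_graph (local_compls G s).
Proof. by elim: s G => //= v s IHs G /(simple_local_compl v); apply: IHs. Qed.

Lemma vertices_local_compls G s : vertices (local_compls G s) = vertices G.
Proof. by elim: s G => //= v s IHs G; rewrite IHs. Qed.

(** A vertex outside the neighbourhood of v keeps its own neighbourhood under
    local complementation at v, so the operations at pairwise nonadjacent
    vertices do not interact: each flips the pairs of neighbours that its
    vertex has in the original graph, and a pair ends up flipped when it is
    flipped an odd number of times. *)
Lemma adjacent_local_compls G s x y :
  {in s &, forall v w, ~~ adjacent G v w} ->
  adjacent (local_compls G s) x y =
  adjacent G x y (+)
    ((x != y) && odd (count (fun v => adjacent G v x && adjacent G v y) s)).
Proof.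
elim: s G => [|v s IHs] G indep /=; first by rewrite andbF addbF.
have adj_s w z : w \in s -> adjacent (local_compl G v) w z = adjacent G w z.
  move=> s_w; rewrite adjacent_local_compl.
  by rewrite (negPf (indep v w _ _)) ?inE ?eqxx ?s_w ?orbT //= andbF addbF.
rewrite IHs => [|w z s_w s_z]; last first.
  by rewrite adj_s //; apply: indep; rewrite inE ?s_w ?s_z orbT.
rewrite adjacent_local_compl oddD oddb -addbA -andb_addr;
  congr (_ (+) (_ && (_ (+) odd _))).
by apply: eq_in_count => w s_w; rewrite !adj_s.
Qed.

End Adjacency.

Section Relabelling.
Variables (T T' : finType) (f : T -> T') (G : graph T).
Hypotheses (sG : simple_graph G) (injf : {in vertices G &, injective f}).

Lemma imset_set2 x y : f @: [set x; y] = [set f x; f y].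
Proof. by rewrite imsetU !imset_set1. Qed.

Lemma simple_relabel : simple_graph (relabel f G).
Proof.
apply/subsetP=> _ /imsetP[e /(subsetP sG)/pairsP[a [b [Ga Gb ab ->]]] ->].
by rewrite imset_set2 set2_pairs !imset_f //= (inj_in_eq injf).
Qed.

Lemma adjacent_relabel : {in vertices G &, forall x y,
  adjacent (relabel f G) (f x) (f y) = adjacent G x y}.
Proof.
move=> x y Gx Gy; rewrite /adjacent -imset_set2.
apply/idP/idP=> [/imsetP[e Ge] | ]; last exact: imset_f.
have /pairsP[a [b [Ga Gb ab def_e]]] := subsetP sG e Ge; rewrite def_e in Ge *.
move/eqP; rewrite !imset_set2 eq_set2 !(inj_in_eq injf) //.
by case/orP=> /andP[/eqP-> /eqP->]; rewrite // setUC.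
Qed.

End Relabelling.

(** * Substituting all vertices of a set *)

Section Blowups.
Variables (V : finType) (m : nat).
Local Notation T := (vertex_names V m).
Implicit Types (G : graph V) (H : V -> graph T) (s : seq V) (v w : V) (x y : T).

Definition base x : V := match x with inl v => v | inr p => p.1 end.

(** The names that survive when the vertices in s have been substituted. *)
Definition in_use s x : bool :=
  match x with inl v => v \notin s | inr p => p.1 \in s end.

Lemma mem_copies v x :
  (x \in copies m v) = (if x is inr p then p.1 == v else false).
Proof.
apply/imsetP/idP => [[i _ ->] /= | ]; first exact: eqxx.
by case: x => // -[w i] /= /eqP->; exists i.
Qed.

Lemma copies_base x v : x \in copies m v -> base x = v.
Proof. by rewrite mem_copies; case: x => // p /eqP. Qed.

Lemma mem_pendant_seq v x :
  (x \in pendant_seq m v) = (if x is inr p then (p.1 == v) && (0 < p.2) else false).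
Proof.
apply/mapP/idP => [[i] | ].
  by rewrite mem_filter => /andP[i_gt0 _] ->; rewrite /= eqxx.
case: x => // -[w i] /= /andP[/eqP-> i_gt0]; exists i => //.
by rewrite mem_filter i_gt0 mem_enum.
Qed.

Lemma old_inj : injective (@old V m).
Proof. by move=> v w []. Qed.

Lemma adjacent_relabel_old G x y : simple_graph G ->
  adjacent (relabel (@old V m) G) x y =
  [&& in_use [::] x, in_use [::] y & adjacent G (base x) (base y)].
Proof.
move=> sG; have inj_old : {in vertices G &, injective (@old V m)}.
  by move=> v w _ _; apply: old_inj.
apply/idP/idP => [adj_xy | ].
  have [/imsetP[v Gv x_v] /imsetP[w Gw y_w] _] :=
    simple_adjacent (simple_relabel sG inj_old) adj_xy.
  by move: adj_xy; rewrite x_v y_w adjacent_relabel.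
case: x y => [v | //] [w | //] /= adj_vw.
by have [Gv Gw _] := simple_adjacent sG adj_vw; rewrite adjacent_relabel.
Qed.

(** The invariant of iterated substitution. A vertex that is still to be
    substituted carries all its edges of G under its original name, and its
    substitution hands them on to its copies; the edges inside a substituted
    graph are never touched again, since later steps only delete original
    names. *)
Lemma substitute_seqP G H s :
    simple_graph G -> (forall v, simple_graph (H v)) ->
    (forall v, vertices (H v) = copies m v) ->
    uniq s -> {subset s <= vertices G} ->
  let K := foldl (fun K v => substitute K (old m v) (H v)) (relabel (@old V m) G) s in
  [/\ simple_graph K,
      vertices K = [set x | in_use s x & base x \in vertices G]
    & forall x y, adjacent K x y =
        [&& in_use s x, in_use s y
          & adjacent G (base x) (base y) || adjacent (H (base x)) x y]].
Proof.
move=> sG sH VH.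
(* The fold substitutes the last vertex of the list last, so the induction has
   to add vertices at the end. *)
elim/last_ind: s => [|s v IHs] /=.
  move=> _ _; split.
  - by apply: simple_relabel sG _ => v w _ _; apply: old_inj.
  - apply/setP=> x; rewrite inE; apply/imsetP/andP=> [[v Gv ->] // | ].
    by case: x => [v [_ Gv] | p []] //; exists v.
  move=> x y; rewrite adjacent_relabel_old //; case: x => [v | p] //=.
  case adjH: (adjacent (H v) (inl v) y); last by rewrite orbF.
  by have [] := simple_adjacent (sH v) adjH; rewrite VH mem_copies.
rewrite rcons_uniq foldl_rcons => /andP[s'v uniq_s] sub_s.
have Gv : v \in vertices G by apply: sub_s; rewrite mem_rcons mem_head.
have {}sub_s : {subset s <= vertices G}.
  by move=> w s_w; apply: sub_s; rewrite mem_rcons inE s_w orbT.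
have{IHs} [sK VK adjK] := IHs uniq_s sub_s.
set K := foldl _ _ s in sK VK adjK *; split.
- apply: simple_substitute => //; rewrite disjoint_subset; apply/subsetP=> x.
  rewrite VK VH !inE mem_copies; case: x => // p /= /andP[s_p _].
  by apply: contraNneq s'v => <-.
- apply/setP=> x; rewrite /= VH !inE VK inE mem_copies.
  case: x => [w | p] /=; rewrite mem_rcons inE.
    by rewrite (inj_eq old_inj) negb_or orbF andbA.
  by case: eqP => [-> | _]; rewrite ?Gv ?orbT ?orbF.
have adjH w x y : adjacent (H w) x y -> (x \in copies m w) /\ (y \in copies m w).
  by move=> /(simple_adjacent (sH w)); rewrite VH => -[-> ->].
have adjHl w a y : adjacent (H w) (inl a) y = false.
  by apply/negP=> /adjH[]; rewrite mem_copies.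
have adjHr w x a : adjacent (H w) x (inl a) = false by rewrite adjacentC adjHl.
have adjHn w p q : (p.1 != w) || (q.1 != w) ->
    adjacent (H w) (inr p) (inr q) = false.
  by rewrite -negb_and; apply: contraNF => /adjH; rewrite !mem_copies => -[-> ->].
have adjG0 w : adjacent G w w = false.
  by apply/negP=> /(simple_adjacent sG)[_ _ /eqP].
move=> x y; rewrite adjacent_substitute !adjK VH !mem_copies.
case: x y => [a | p] [b | q];
  rewrite /= !mem_rcons !inE ?(inj_eq old_inj) ?s'v /= ?(adjHl, adjHr) ?orbF
    ?negb_or.
- rewrite !(eq_sym v) -!andbA.
  by case: (a == v); rewrite ?andbF //=; case: (b == v); rewrite ?andbF.
- rewrite (eq_sym v) -andbA; have [-> | _] := eqVneq a v.
    by rewrite adjG0 !andbF.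
  have [q_v | _] := eqVneq q.1 v; rewrite ?orbF //= q_v (negPf s'v) andbF /=.
  by rewrite adjacentC.
- rewrite (eq_sym v) ?orbF; have [-> | _] := eqVneq b v.
    by rewrite adjG0 !andbF.
  have [p_v | _] := eqVneq p.1 v; rewrite ?orbF //= p_v (negPf s'v) /=.
  by [].
have [p_v | p'v] := eqVneq p.1 v; have [q_v | q'v] := eqVneq q.1 v.
- by rewrite p_v q_v (negPf s'v) adjG0 /= ?andbF ?orbF.
- rewrite p_v (negPf s'v) /= orbF.
  by rewrite (adjHn v) ?q'v ?orbT ?orbF.
- rewrite (adjHn v) ?p'v // (adjHn p.1) ?q_v ?(eq_sym v) ?p'v ?orbT //.
  by rewrite (negPf s'v) !(andbF, orbF) /= adjacentC.
by rewrite (adjHn v) ?p'v // !orbF.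
Qed.

Lemma CmP G : simple_graph G ->
  [/\ simple_graph (Cm m G),
      forall x, (x \in vertices (Cm m G)) =
        (if x is inr p then p.1 \in vertices G else false)
    & {in vertices (Cm m G) &, forall x y, adjacent (Cm m G) x y =
        adjacent G (base x) (base y) || (base x == base y) && (x != y)}].
Proof.
move=> sG; have [||||sC VC adjC] :=
  @substitute_seqP G (fun v => complete (copies m v)) (enum (vertices G)) sG.
- by move=> v; apply: simple_complete.
- by [].
- exact: enum_uniq.
- by move=> v; rewrite mem_enum.
have memC x : (x \in vertices (Cm m G)) =
    (if x is inr p then p.1 \in vertices G else false).
  by rewrite VC inE; case: x => [v | p] /=; rewrite mem_enum ?andNb ?andbb.
split=> // x y; rewrite !memC adjC; case: x y => // p [// | q] Gp Gq.
by rewrite /= !mem_enum Gp Gq adjacent_complete !mem_copies eqxx (eq_sym q.1).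
Qed.

End Blowups.

(** * Adding pendants *)

Lemma add_pendant_seqP (T : finType) (K : graph T) (v : T) (s : seq T) :
    simple_graph K -> v \in vertices K -> v \notin s ->
  let K' := foldl (fun K p => add_pendant K v p) K s in
  [/\ simple_graph K', vertices K' = vertices K :|: [set p in s]
    & forall x y, adjacent K' x y =
        [|| adjacent K x y, (x == v) && (y \in s) | (y == v) && (x \in s)]].
Proof.
elim: s K => [|p s IHs] K sK Kv /=.
  split=> // [|x y]; first by apply/setP=> x; rewrite !inE orbF.
  by rewrite !in_nil !andbF !orbF.
rewrite inE negb_or => /andP[vp s'v].
have [||//|sK' VK' adjK'] := IHs (add_pendant K v p).
- exact: simple_add_pendant.
- by rewrite !inE Kv orbT.
split=> // [|x y].
  by rewrite VK'; apply/setP=> x; rewrite !inE orbCA orbA.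
rewrite adjK' adjacent_add_pendant eq_set2 !inE.
by case: (adjacent K x y) (x == v) (y == v) (x == p) (y == p) (x \in s) (y \in s)
  => [] [] [] [] [] [] [].
Qed.

Section Split.
Variables (V : finType) (m : nat).
Local Notation T := (vertex_names V m).
Implicit Types (G : graph V) (K : graph T) (U W : {set V}) (s : seq V) (x y : T).

Definition pendant_edge s x y : bool :=
  match x, y with
  | inl w, inr p | inr p, inl w => [&& w \in s, p.1 == w & 0 < p.2]
  | _, _ => false
  end.

Lemma add_pendants_seqP K s :
    simple_graph K -> {in s, forall w, old m w \in vertices K} ->
  let K' := foldl (@add_pendants V m) K s in
  [/\ simple_graph K',
      forall x, (x \in vertices K') = (x \in vertices K)
        || (if x is inr p then (p.1 \in s) && (0 < p.2) else false)
    & forall x y, adjacent K' x y = adjacent K x y || pendant_edge s x y].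
Proof.
elim: s K => [|w s IHs] K sK Ks /=.
  by split=> // [[v | p] | [v | p] [w | q]]; rewrite ?orbF.
have [||sK1 VK1 adjK1] := @add_pendant_seqP _ K (old m w) (pendant_seq m w) sK.
- by apply: Ks; rewrite mem_head.
- by rewrite mem_pendant_seq.
have [|sK' VK' adjK'] := IHs (add_pendants K w) sK1.
  by move=> v s_v; rewrite VK1 inE Ks // inE s_v orbT.
split=> // [x | x y].
  rewrite VK' VK1 !inE mem_pendant_seq -orbA; case: x => [v | p] //.
  by rewrite inE -andb_orl.
rewrite adjK' adjK1 -orbA; congr (_ || _); rewrite !mem_pendant_seq.
by case: x y => [v | p] [v' | q];
  rewrite /= ?(inj_eq (@old_inj V m)) ?andbF ?orbF //= inE;
  rewrite ?andb_orl; congr (_ || _); case: eqP => // ->; rewrite ?(eq_sym w).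
Qed.

(** Bipartiteness removes every edge that is not incident with a vertex of W
    keeping its original name: the copies of U are pairwise nonadjacent, as are
    the vertices of W, and a pendant only meets the vertex that carries it. *)
Lemma SmP G U W a b : simple_graph G -> bipartite_parts G U W a b ->
  [/\ simple_graph (Sm m G U W),
      forall x, (x \in vertices (Sm m G U W)) =
        match x with
        | inl v => v \in W
        | inr p => (p.1 \in U) || (p.1 \in W) && (0 < p.2)
        end
    & forall x y, adjacent (Sm m G U W) x y =
        match x, y with
        | inl w, inr p | inr p, inl w =>
          (w \in W) && (if p.1 \in U then adjacent G w p.1
                        else (p.1 == w) && (0 < p.2))
        | _, _ => false
        end].
Proof.
move=> sG [VG dUW [indU indW] _].
have U'W v : v \in W -> v \in U = false by apply: disjointFl.
have in_W v : v \in vertices G -> v \notin U -> v \in W.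
  by rewrite VG inE => /orP[-> | ].
have [||||sK VK adjK] :=
  @substitute_seqP _ m G (fun v => edgeless (copies m v)) (enum U) sG.
- by move=> v; apply: simple_edgeless.
- by [].
- exact: enum_uniq.
- by move=> v; rewrite mem_enum VG inE => ->.
have [w | sS VS adjS] := add_pendants_seqP (s := enum W) sK.
  by rewrite VK !inE /= !mem_enum => Ww; rewrite U'W // VG inE Ww orbT.
have adj_sparse w (p : V * 'I_m) : w \notin U ->
    (p.1 \in U) && adjacent G w p.1 || [&& w \in W, p.1 == w & 0 < p.2] =
    (w \in W) && (if p.1 \in U then adjacent G w p.1 else (p.1 == w) && (0 < p.2)).
  (* For p above U the pendant term vanishes, and w is in W as soon as it has
     a neighbour. *)
  move=> U'w; have [Up | U'p] /= := boolP (p.1 \in U); last by [].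
  have /negPf->: p.1 != w by apply: contraTneq Up => ->.
  rewrite andbF orbF; case adj_wp: (adjacent G w p.1); rewrite ?andbF //.
  by have [/in_W->] := simple_adjacent sG adj_wp.
split=> // [x | x y].
  rewrite VS VK inE; case: x => [v | p] /=; rewrite !mem_enum.
    rewrite orbF VG inE; case: (boolP (v \in W)) => [/U'W-> // | _].
    by rewrite orbF andNb.
  by rewrite VG inE; case: (p.1 \in U).
rewrite adjS adjK adjacent_edgeless orbF.
case: x y => [v | p] [w | q]; rewrite /= !mem_enum ?orbF.
- apply/and3P=> -[U'v U'w adj_vw]; have [Gv Gw _] := simple_adjacent sG adj_vw.
  by case/negP: (indW v w (in_W v Gv U'v) (in_W w Gw U'w)).
- have [Uv | U'v] /= := boolP (v \in U); last exact: adj_sparse.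
  by have /negPf-> : v \notin W by apply: contraL Uv => /U'W->.
- rewrite adjacentC; have [Uw | U'w] /= := boolP (w \in U).
    by rewrite andbF; have /negPf-> : w \notin W by apply: contraL Uw => /U'W->.
  exact: adj_sparse.
by apply/and3P=> -[Up Uq adj_pq]; case/negP: (indU _ _ Up Uq).
Qed.

(** * The parity count *)

Lemma count_enum_set (A : {set V}) s P : perm_eq s (enum A) ->
  count P s = #|[set v in A | P v]|.
Proof.
move=> /permP->; rewrite cardE -size_filter; congr size.
by rewrite {1}/enum_mem -filter_predI; apply: eq_filter => v; rewrite !inE andbC.
Qed.

Lemma odd_card_single (A : {set V}) (P : pred V) v :
  v \in A -> odd #|[set w in A | P w && (v == w)]| = P v.
Proof.
move=> Av; case Pv: (P v).
  rewrite (_ : [set _ in A | _] = [set v]) ?cards1 //; apply/setP=> w.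
  by rewrite !inE eq_sym; case: eqP => [-> | _]; rewrite ?Av ?Pv ?andbF.
rewrite (_ : [set _ in A | _] = set0) ?cards0 //; apply/setP=> w.
by rewrite !inE; case: eqP => [<- | _]; rewrite ?Pv ?andbF.
Qed.

(** The parity hypotheses enter here, for two copies of vertices of U; all other
    pairs have at most one common neighbour in W. *)
Lemma adjacent_local_compls_Sm G U W a b s :
    simple_graph G -> bipartite_parts G U W a b ->
    (forall u, u \in U -> odd (degree G u)) ->
    (forall u u', u \in U -> u' \in U -> u != u' -> ~~ odd #|common_nbhd G u u'|) ->
    perm_eq s (enum W) ->
  {in vertices (Sm m G U W) &, forall x y,
    adjacent (local_compls (Sm m G U W) (map (@old V m) s)) x y =
    adjacent G (base x) (base y) || (base x == base y) && (x != y)}.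
Proof.
move=> sG bipG odd_deg even_common s_W.
have [VG dUW [indU indW] _] := bipG.
have [sS VS adjS] := SmP sG bipG.
have U'W v : v \in W -> v \in U = false by apply: disjointFl.
have nbhdU u v : u \in U -> adjacent G v u -> v \in W.
  move=> Uu adj_vu; have [] := simple_adjacent sG adj_vu; rewrite VG inE.
  by case/orP=> // Uv; case/negP: (indU v u Uv Uu).
have adjWF v w : v \in W -> w \in W -> adjacent G v w = false.
  by move=> Wv Ww; apply: negPf (indW v w Wv Ww).
move=> x y; rewrite !VS => Sx Sy.
rewrite adjacent_local_compls; last first.
  by move=> _ _ /mapP[v _ ->] /mapP[w _ ->]; rewrite adjS.
have [<- | neq_xy] := eqVneq x y.
  rewrite !andbF addbF orbF; apply/idP/idP=> /simple_adjacent[] //.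
    by rewrite eqxx.
  by rewrite eqxx.
rewrite andbT /= count_map (count_enum_set _ s_W) adjS.
set N := [set v in W | _].
have N_old v : (x == inl v) || (y == inl v) -> N = set0.
  move=> xy_v; apply/setP=> w; rewrite !inE /= !adjS.
  by case/orP: xy_v => /eqP->; rewrite !andbF.
case: x y Sx Sy @N N_old neq_xy => [v | p] [w | q] Sx Sy N N_old neq_xy.
- rewrite (N_old v) ?eqxx // cards0 adjWF //=.
  by apply/esym/negbTE; apply: contraNneq neq_xy => ->.
- rewrite (N_old v) ?eqxx // cards0 addbF Sx /=.
  case: ifP Sy => [Uq _ | _ /= /andP[Wq ->]]; last by rewrite adjWF // andbT eq_sym.
  have /negPf->: v != q.1 by apply: contraTneq Uq => <-; rewrite U'W.
  by rewrite orbF.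
- rewrite (N_old w) ?eqxx ?orbT // cards0 addbF Sy /= adjacentC.
  case: ifP Sx => [Up _ | _ /= /andP[Wp ->]]; last by rewrite adjWF // andbT.
  have /negPf->: p.1 != w by apply: contraTneq Up => ->; rewrite U'W.
  by rewrite orbF.
(* From here on both names carry an index: copies above U, pendants above W. *)
rewrite addFb {N_old} /=.
have pendE (p' : V * 'I_m) v adj :
    (p'.1 \in U) || (p'.1 \in W) && (0 < p'.2) ->
    (if p'.1 \in U then adj else (p'.1 == v) && (0 < p'.2)) =
    (if p'.1 \in U then adj else p'.1 == v).
  by case: (p'.1 \in U) => //= /andP[_ ->]; rewrite andbT.
have defN : N = [set v in W | (if p.1 \in U then adjacent G v p.1 else p.1 == v)
                           && (if q.1 \in U then adjacent G v q.1 else q.1 == v)].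
  apply/setP=> v; rewrite !inE /= !adjS; case Wv: (v \in W) => //=.
  by rewrite Wv !pendE.
rewrite {N}defN; move: Sx Sy; case Up: (p.1 \in U); case Uq: (q.1 \in U);
  [move=> _ _ | move=> _ /= /andP[Wq _] | move=> /= /andP[Wp _] _
  | move=> /= /andP[Wp _] /andP[Wq _]].
- rewrite (negPf (indU _ _ Up Uq)) /=.
  have -> : [set v in W | adjacent G v p.1 && adjacent G v q.1] = common_nbhd G p.1 q.1.
    apply/setP=> v; rewrite !inE ![adjacent G v _]adjacentC.
    by case adj_pv: (adjacent G p.1 v); rewrite ?andbF // (nbhdU p.1) // adjacentC.
  case: eqVneq => [<- | neq_pq]; last exact: negPf (even_common _ _ Up Uq neq_pq).
  by rewrite /common_nbhd setIid odd_deg.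
- rewrite odd_card_single // [LHS]adjacentC.
  have /negPf-> : p.1 != q.1 by apply: contraTneq Up => ->; rewrite U'W.
  by rewrite orbF.
- under eq_finset do rewrite [X in _ && X]andbC.
  rewrite odd_card_single //.
  have /negPf-> : p.1 != q.1 by apply: contraTneq Uq => <-; rewrite U'W.
  by rewrite orbF.
by rewrite adjWF // odd_card_single.
Qed.

(** * Identifying the vertices *)

(** The identification carries each part of S^m(G), the names lying above one
    vertex of G, onto m copies, and a part has at most m elements, so
    it is injective on each part; different parts have disjoint images. *)
Lemma identificationP G U W a b f :
    0 < m -> simple_graph G -> bipartite_parts G U W a b -> identification U W f ->
  [/\ {in vertices (Sm m G U W), forall x, base (f x) = base x},
      {in vertices (Sm m G U W) &, injective f}
    & f @: vertices (Sm m G U W) = vertices (Cm m G)].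
Proof.
move=> m_gt0 sG bipG [fU fW]; have [VG dUW _ _] := bipG.
have [_ VS _] := SmP sG bipG; have [_ VC _] := CmP m sG.
pose part v := if v \in U then copies m v else old m v |: [set p in pendant_seq m v].
have memS x : (x \in vertices (Sm m G U W)) =
    (base x \in vertices G) && (x \in part (base x)).
  rewrite VS VG inE /part; case: x => [v | p] /=; case: ifP => [Uv | _].
  - by rewrite mem_copies andbF (disjointFr dUW).
  - by rewrite !inE eqxx andbT.
  - by rewrite mem_copies eqxx.
  - by rewrite !inE mem_pendant_seq eqxx.
have f_part v : v \in vertices G -> f @: part v = copies m v.
  rewrite VG inE /part; case: ifP => [/fU-> // | _ /=]; exact: fW.
have card_part v : #|part v| <= #|copies m v|.
  rewrite /part; case: ifP => // _.
  (* The inverse of the matching that sends w to its copy of index 0, which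
     shows that w and its pendants are at most m in number. *)
  pose h x : T := if x is inr p then (if 0 < p.2 then inr p else inl p.1) else x.
  apply: leq_trans (leq_imset_card h (copies m v)).
  apply/subset_leq_card/subsetP=> x; rewrite !inE mem_pendant_seq.
  case: x => [w | p] /=.
    rewrite orbF => /eqP[->]; apply/imsetP.
    by exists (inr (v, Ordinal m_gt0)); rewrite ?mem_copies /=.
  by case/andP=> p_v p_gt0; apply/imsetP; exists (inr p); rewrite ?mem_copies //= p_gt0.
have f_copies x : x \in vertices (Sm m G U W) -> f x \in copies m (base x).
  by rewrite memS => /andP[Gx part_x]; rewrite -f_part // imset_f.
have base_f : {in vertices (Sm m G U W), forall x, base (f x) = base x}.
  by move=> x /f_copies/copies_base.
split=> // [x y Sx Sy eq_f |].
  have eq_b : base x = base y by rewrite -(base_f x) // eq_f base_f.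
  move: Sx Sy; rewrite !memS -eq_b => /andP[Gx part_x] /andP[_ part_y].
  have /imset_injP inj_f : #|f @: part (base x)| == #|part (base x)|.
    by rewrite eqn_leq leq_imset_card f_part ?card_part.
  exact: inj_f.
apply/setP=> y; rewrite VC; apply/imsetP/idP=> [[x Sx ->] | ].
  have := f_copies x Sx; rewrite mem_copies; case: (f x) => // p /eqP->.
  by move: Sx; rewrite memS => /andP[].
case: y => // p Gp; have : inr p \in copies m p.1 by rewrite mem_copies.
rewrite -f_part // => /imsetP[x part_x ->]; exists x => //.
suff base_x : base x = p.1 by rewrite memS base_x Gp.
move: part_x; rewrite /part; case: ifP => _; first exact: copies_base.
by rewrite !inE mem_pendant_seq => /orP[/eqP-> // | ]; case: x => // q /andP[/eqP].
Qed.

End Split.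

Theorem theorem9 (V : finType) (G : graph V) (U W : {set V}) (n r m : nat)
  (ws : seq V) (f : vertex_names V m -> vertex_names V m)
  (simpleG : simple_graph G)
  (r_le_n : r <= n)
  (bipG : bipartite_parts G U W r (n - r))
  (m_gt1 : 1 < m)
  (odd_deg : forall u, u \in U -> odd (degree G u))
  (even_common : forall u u', u \in U -> u' \in U -> u != u' ->
     ~~ odd #|common_nbhd G u u'|)
  (enumW : perm_eq ws (enum W))
  (idf : identification U W f) :
  Cm m G = relabel f (local_compls (Sm m G U W) (map (@old V m) ws)).
Proof.
have [sC VC adjC] := CmP m simpleG; have [sS _ _] := SmP m simpleG bipG.
have [base_f inj_f im_f] := identificationP (ltnW m_gt1) simpleG bipG idf.
have sL := simple_local_compls (map (@old V m) ws) sS.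
have inj_fL :
    {in vertices (local_compls (Sm m G U W) (map (@old V m) ws)) &, injective f}.
  by rewrite vertices_local_compls.
apply: graph_ext => //; first exact: simple_relabel.
  by rewrite /= vertices_local_compls im_f.
move=> x' y'; rewrite -im_f => /imsetP[x Sx ->] /imsetP[y Sy ->].
rewrite adjC -?im_f ?imset_f // adjacent_relabel ?vertices_local_compls //.
rewrite (adjacent_local_compls_Sm simpleG bipG) // !base_f //.
by rewrite (inj_in_eq inj_f).
Qed.
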